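(* Let $b\ge 2$ and $n,d\ge 1$ be integers, let $\omega$ be a primitive $d$th root of unity, and let $g=\gcd(b,d)$. (a) If $d\mid n$ then $$\sum_{k=0}^{(b-1)n}\genfrac{[}{]}{0pt}{}{n}{k}_\omega^{(b)}t^k=\left(\frac{(1-t^{bd/g})^g}{1-t^d}\right)^{n/d}.$$ When $g=1$ this becomes $\sum_{k=0}^{(b-1)n}\genfrac{[}{]}{0pt}{}{n}{k}_\omega^{(b)}t^k=\left(\frac{1-(t^d)^b}{1-t^d}\right)^{n/d}=[b]_{t^d}^{\,n/d}$, and hence $$\genfrac{[}{]}{0pt}{}{n}{k}_\omega^{(b)}=\binom{n/d}{k/d}^{(b)}.$$ (b) If $d\mid(n-1)$ then $$\sum_{k=0}^{(b-1)n}\genfrac{[}{]}{0pt}{}{n}{k}_\omega^{(b)}t^k=[b]_t\left(\frac{(1-t^{bd/g})^g}{1-t^d}\right)^{(n-1)/d}.$$ When $g=1$ this becomes $\sum_{k=0}^{(b-1)n}\genfrac{[}{]}{0pt}{}{n}{k}_\omega^{(b)}t^k=[b]_t\,[b]_{t^d}^{(n-1)/d}$, and hence $$\genfrac{[}{]}{0pt}{}{n}{k}_\omega^{(b)}=\sum_{\ell=0}^{b-1}\binom{(n-1)/d}{(k-\ell)/d}^{(b)}.$$ (c) If $d\mid(n+1)$ then $$\sum_{k=0}^{(b-1)n}\omega^k\genfrac{[}{]}{0pt}{}{n}{k}_\omega^{(b)}t^k=\frac{1}{[b]_t}\left(\frac{(1-t^{bd/g})^g}{1-t^d}\right)^{(n+1)/d}.$$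 When $g=1$ this becomes $\sum_{k=0}^{(b-1)n}\omega^k\genfrac{[}{]}{0pt}{}{n}{k}_\omega^{(b)}t^k=\frac{1}{[b]_t}[b]_{t^d}^{(n+1)/d}$. In the special case $b=2$ and $d=n+1$, with $g=\gcd(2,n+1)$, one has $$\frac{1}{[2]_t}\left(\frac{(1-t^{2(n+1)/g})^g}{1-t^{n+1}}\right)=1-t+t^2-\cdots+(-1)^nt^n,$$ and hence $$e_k(\omega,\omega^2,\ldots,\omega^n)=\omega^k\genfrac{[}{]}{0pt}{}{n}{k}_\omega^{(2)}=\omega^{k(k+1)/2}\genfrac{[}{]}{0pt}{}{n}{k}_\omega=\begin{cases}(-1)^k & k<n+1,\\ 0 & k\ge n+1.\end{cases}$$
   Context: Here $t$ is an indeterminate and $[m]_x:=1+x+\cdots+x^{m-1}$. The integers $\binom{n}{k}^{(b)}$ are defined by $\sum_k\binom{n}{k}^{(b)}t^k=(1+t+\cdots+t^{b-1})^n$, and the polynomials $\genfrac{[}{]}{0pt}{}{n}{k}_q^{(b)}\in\mathbb{N}[q]$ by $$\sum_{k}\genfrac{[}{]}{0pt}{}{n}{k}_q^{(b)}t^k=\prod_{i=0}^{n-1}\left(1+q^it+\cdots+(q^it)^{b-1}\right).$$ Both are defined to be $0$ when $n$ or $k$ is not an integer (and when $k$ is an integer outside the range of exponents occurring). $\genfrac{[}{]}{0pt}{}{n}{k}_\omega^{(b)}$ denotes evaluation at $q=\omega$. $\genfrac{[}{]}{0pt}{}{n}{k}_q=\frac{[n]_q!}{[k]_q!\,[n-k]_q!}$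 (with $[m]_q!=[m]_q[m-1]_q\cdots[1]_q$) is the usual $q$-binomial coefficient, a polynomial in $q$ (zero for $k>n$), and $\genfrac{[}{]}{0pt}{}{n}{k}_\omega$ is its value at $q=\omega$. $e_k$ is the $k$th elementary symmetric polynomial. *)

(* Defs.v *)
From mathcomp Require Import all_boot all_order all_algebra.
From mathcomp.multinomials Require Export mpoly.
Set Implicit Arguments.
Unset Strict Implicit.
Unset Printing Implicit Defensive.
Import GRing.Theory Num.Theory.
Local Open Scope ring_scope.

(* [m]_x = 1 + x + ... + x^(m-1) *)
Definition bracket (R : pzSemiRingType) (m : nat) (x : R) : R :=
  \sum_(i < m) x ^+ i.

(* The polynomial coefficients and their q-analogues take rational arguments,
   because the conventions give them the value 0 at non-integer arguments (such
   as k / d). The generating function is only defined for a natural upper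
   index; the value at a negative upper index is immaterial and set to 0. *)

(* Coefficient of t^k in (1 + t + ... + t^(b-1))^n. *)
Definition polynomial_coef (b : nat) (n k : rat) : int :=
  if (n \is a Num.nat) && (k \is a Num.nat)
  then ((bracket b 'X : {poly int}) ^+ Num.truncn n)`_(Num.truncn k)
  else 0.

(* Coefficient of t^k in \prod_(i < n) (1 + q^i t + ... + (q^i t)^(b-1)).
   In {poly {poly int}} the outer variable 'X is t, and q is 'X%:P. *)
Definition qpolynomial_coef (b : nat) (n k : rat) : {poly int} :=
  if (n \is a Num.nat) && (k \is a Num.nat)
  then (\prod_(i < Num.truncn n)
          bracket b (('X ^+ i)%:P * 'X : {poly {poly int}}))`_(Num.truncn k)
  else 0.

Definition qfactorial (m : nat) : {poly int} :=
  \prod_(1 <= i < m.+1) bracket i 'X.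

(* The divisor is monic, so %/ is the genuine Euclidean quotient over int, and
   the division is exact. *)
Definition qbinomial (n k : nat) : {poly int} :=
  if (k <= n)%N then qfactorial n %/ (qfactorial k * qfactorial (n - k)) else 0.

(* Value at q = w of a polynomial in q with integer coefficients. *)
Definition eval_at (R : nzRingType) (w : R) (p : {poly int}) : R :=
  (map_poly intr p).[w].

(* Constants and the indeterminate t of the field of rational functions C(t). *)
Definition ratfun_const (C : fieldType) (c : C) : {fraction {poly C}} :=
  tofrac c%:P.
Definition ratfun_t (C : fieldType) : {fraction {poly C}} := tofrac 'X.

(* Main.v *)
(* Evaluated at q = w, the generating function is the product over i < n of
   [b]_{w^i t}. Its factors are d-periodic in i, and over one period
   multiplying by prod_i (1 - w^i t) = 1 - t^d turns the product into
   prod_i (1 - (w^b)^i t^b) = (1 - t^(bd/g))^g, because w^b is a primitive root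
   of order d/g. This is (a); for (b) the last factor, i = n - 1, is [b]_t, and
   for (c) substituting wt for t yields the product over i < n + 1 with its
   factor i = 0, namely [b]_t, removed. The coefficient identities are read off
   after pulling these equalities back along the embedding of C[t] in C(t). *)
Require Import Defs.
From mathcomp Require Import all_boot all_order all_algebra.
From mathcomp Require Import ring.
From mathcomp.multinomials Require Import mpoly.
Set Implicit Arguments.
Unset Strict Implicit.
Unset Printing Implicit Defensive.
Import GRing.Theory Num.Theory.
Local Open Scope ring_scope.

(** * Elementary identities for the bracket *)

Lemma rmorph_bracket (R S : pzSemiRingType) (f : {rmorphism R -> S}) m x :
  f (bracket m x) = bracket m (f x).
Proof.
by rewrite /bracket rmorph_sum; apply: eq_bigr => i _; rewrite rmorphXn.
Qed.

Lemma bracket2 (R : pzSemiRingType) (x : R) : bracket 2 x = 1 + x.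
Proof. by rewrite /bracket !big_ord_recl big_ord0 addr0 expr0 expr1. Qed.

Lemma bracket_geometric (R : comPzRingType) m (x : R) :
  bracket m x * (1 - x) = 1 - x ^+ m.
Proof.
by rewrite mulrC -(opprB x) -(opprB (x ^+ m)) subrX1 mulNr.
Qed.

(** * Products over the powers of a primitive root *)

Section PrimitiveRoot.

Variables (F : fieldType) (d : nat) (z : F).
Hypothesis z_prim : d.-primitive_root z.

(** This is the factorization of X^d - 1 over the powers of [z], evaluated at [x^-1] and multiplied
    by [x ^+ d]; hence [x = 0] is treated apart. *)
Lemma prod_1sub_primitive_root (x : F) :
  \prod_(i < d) (1 - z ^+ i * x) = 1 - x ^+ d.
Proof.
have d_gt0 := prim_order_gt0 z_prim.
have [->|x_neq0] := eqVneq x 0.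
  rewrite expr0n eqn0Ngt d_gt0 subr0 big1 // => i _.
  by rewrite mulr0 subr0.
have /(congr1 (horner^~ x^-1)) := factor_Xn_sub_1 z_prim.
rewrite big_mkord horner_prod !hornerE => E.
transitivity (x ^+ d * (x^-1 ^+ d - 1)); last first.
  by rewrite mulrBr mulr1 -exprMn divff // expr1n.
rewrite -E -[in x ^+ _](card_ord d) -prodr_const -big_split /=.
apply: eq_bigr => i _.
by rewrite !hornerE mulrBr divff // [x * _]mulrC.
Qed.

Lemma prod_primitive_root_periodic (f : F -> F) m :
  \prod_(i < m * d) f (z ^+ i) = (\prod_(i < d) f (z ^+ i)) ^+ m.
Proof.
rewrite -(big_mkord xpredT (fun i => f (z ^+ i))) big_nat_mul.
rewrite -[m in RHS]subn0 -prodr_const_nat; apply: eq_bigr => k _.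
rewrite -{1}[(k * d)%N]add0n big_addn mulSn addnK big_mkord.
apply: eq_bigr => i _.
by rewrite exprD mulnC exprM (prim_expr_order z_prim) expr1n mulr1.
Qed.

End PrimitiveRoot.

(** * The product of brackets over whole periods *)

Section BracketProduct.

Variables (F : fieldType) (d : nat) (z : F).
Hypothesis z_prim : d.-primitive_root z.

(** The form without division also covers [x ^+ d = 1], where the quotient would be degenerate. *)
Lemma prod_bracket_period b (x : F) :
  \prod_(i < d) bracket b (z ^+ i * x) * (1 - x ^+ d)
  = (1 - x ^+ (b * d %/ gcdn b d)) ^+ gcdn b d.
Proof.
rewrite -(prod_1sub_primitive_root z_prim) -big_split /=.
under eq_bigr do rewrite bracket_geometric exprMn -exprM mulnC exprM.
have g_dvd : (gcdn b d %| d)%N := dvdn_gcdr b d.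
have zb_prim := exp_prim_root z_prim b.
(* As [z ^+ b] has order d/g with g = [gcdn b d], the d factors form g full periods; this is the
   outer exponent g. *)
have := prod_primitive_root_periodic zb_prim (fun y => 1 - y * x ^+ b)
  (gcdn b d).
rewrite mulnC divnK // => ->.
by rewrite (prod_1sub_primitive_root zb_prim) -exprM muln_divA.
Qed.

Lemma prod_bracket b (x : F) n : x ^+ d != 1 -> (d %| n)%N ->
  \prod_(i < n) bracket b (z ^+ i * x)
  = ((1 - x ^+ (b * d %/ gcdn b d)) ^+ gcdn b d / (1 - x ^+ d)) ^+ (n %/ d).
Proof.
move=> x_ord /dvdnP[m ->].
rewrite mulnK ?(prim_order_gt0 z_prim) //.
rewrite (prod_primitive_root_periodic z_prim (fun y => bracket b (y * x))).
by rewrite -prod_bracket_period mulfK // subr_eq0 eq_sym.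
Qed.

End BracketProduct.

(** * The generating function specialized at q = w *)

Section Evaluation.

Variables (R : comNzRingType) (w : R).

(* Specialization of the generating function of [qpolynomial_coef] at q = w. *)
Definition qpolynomial_gf (b n : nat) : {poly R} :=
  \prod_(i < n) bracket b ((w ^+ i)%:P * 'X).

(** Evaluation at q = w is a ring morphism, so applying it to each coefficient in t commutes with
    the product and the brackets. *)
Lemma eval_at_qpolynomial b (n k : nat) :
  eval_at w (qpolynomial_coef b n%:Q k%:Q) = (qpolynomial_gf b n)`_k.
Proof.
pose f : {rmorphism {poly int} -> R} := horner_eval w \o map_poly intr.
rewrite /qpolynomial_coef -!pmulrn !natr_nat /= !natrK.
rewrite -[LHS]/(f _) -coef_map; congr (nth _ (polyseq _) _).
rewrite /qpolynomial_gf rmorph_prod; apply: eq_bigr => i _.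
rewrite rmorph_bracket rmorphM /= map_polyX map_polyC /=.
by rewrite rmorphXn /= map_polyX /horner_eval hornerXn.
Qed.

Lemma eval_at_qpolynomial_neg b (n k : nat) :
  eval_at w (qpolynomial_coef b n%:Q (Negz k)%:Q) = 0.
Proof.
rewrite /qpolynomial_coef [X in _ && X]natrEint ler0z !andbF.
by rewrite /eval_at rmorph0 horner0.
Qed.

Lemma size_bracket_linear b (c : R) :
  (size (bracket b (c%:P * 'X)) <= b)%N.
Proof.
apply: (leq_trans (size_sum _ _ _)); apply/bigmax_leqP => i _.
rewrite exprMn -polyC_exp mul_polyC (leq_trans (size_scale_leq _ _)) //.
by rewrite size_polyXn.
Qed.

(** This degree bound shows that sums over k up to (b-1)n miss no coefficient. *)
Lemma size_qpolynomial_gf b n : (0 < b)%N ->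
  (size (qpolynomial_gf b n) <= ((b - 1) * n).+1)%N.
Proof.
case: b => // b _; rewrite subn1 /=; elim: n => [|n IHn].
  by rewrite /qpolynomial_gf big_ord0 size_poly1 muln0.
rewrite /qpolynomial_gf big_ord_recr /=.
apply: (leq_trans (size_polyMleq _ _)).
rewrite -subn1 leq_subLR.
apply: (leq_trans (leq_add IHn (size_bracket_linear b.+1 (w ^+ n)))).
by rewrite mulnS add1n addSn addnS [(b + _)%N]addnC.
Qed.

Lemma coef_comp_poly_scaleX (p : {poly R}) k :
  (p \Po (w *: 'X))`_k = w ^+ k * p`_k.
Proof.
have -> : p \Po (w *: 'X) = \poly_(i < size p) (p`_i * w ^+ i).
  rewrite comp_polyE poly_def; apply: eq_bigr => i _.
  by rewrite exprZn scalerA.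
by rewrite coef_poly [RHS]mulrC; case: ltnP => // /(nth_default 0) ->;
  rewrite mul0r.
Qed.

(** Raising every exponent of [w] by one is the substitution of wt for t. *)
Lemma coef_qpolynomial_gf_scale b n k :
  (\prod_(i < n) bracket b ((w ^+ i.+1)%:P * 'X))`_k
  = w ^+ k * (qpolynomial_gf b n)`_k.
Proof.
have -> : \prod_(i < n) bracket b ((w ^+ i.+1)%:P * 'X)
          = qpolynomial_gf b n \Po (w *: 'X).
  rewrite /qpolynomial_gf rmorph_prod; apply: eq_bigr => i _ /=.
  rewrite rmorph_bracket /= comp_polyM comp_polyC comp_polyX.
  by rewrite -mul_polyC mulrA -polyCM -exprSr.
by rewrite coef_comp_poly_scaleX.
Qed.

End Evaluation.

(** * Passage to the field C(t) *)

Section RationalFunctions.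

Variable C : fieldType.
Let K := {fraction {poly C}}.
Let t : K := ratfun_t C.

(** This makes the denominators 1 - t^d invertible, so that the quotients are genuine ones. *)
Lemma ratfun_t_expr_neq1 d : (0 < d)%N -> t ^+ d != 1.
Proof.
move=> d_gt0; rewrite /t /ratfun_t -tofracXn -tofrac1 tofrac_eq.
apply/eqP => /(congr1 (fun p : {poly C} => size p)) /eqP.
by rewrite size_polyXn size_poly1 eqSS eqn0Ngt d_gt0.
Qed.

Lemma bracket_ratfun_t_neq0 b : (0 < b)%N -> bracket b t != 0.
Proof.
move=> b_gt0; apply: contraTneq (ratfun_t_expr_neq1 b_gt0) => E.
by rewrite negbK eq_sym -subr_eq0 -bracket_geometric E mul0r.
Qed.

(** The point [x] is left free: it will be t for (a) and (b), and wt for (c). *)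
Lemma sum_qpolynomial b (n : nat) (w : C) (x : K) : (0 < b)%N ->
  \sum_(0 <= k < ((b - 1) * n).+1)
     ratfun_const (eval_at w (qpolynomial_coef b n%:Q k%:Q)) * x ^+ k
  = \prod_(i < n) bracket b (ratfun_const w ^+ i * x).
Proof.
move=> b_gt0.
pose f : {rmorphism C -> K} := @tofrac {poly C} \o polyC.
transitivity (map_poly f (qpolynomial_gf w b n)).[x].
  rewrite (@horner_coef_wide _ ((b - 1) * n).+1); last first.
    by rewrite size_map_poly size_qpolynomial_gf.
  rewrite big_mkord; apply: eq_bigr => k _.
  by rewrite eval_at_qpolynomial coef_map.
rewrite /qpolynomial_gf rmorph_prod horner_prod; apply: eq_bigr => i _.
rewrite rmorph_bracket /= -[LHS]/(horner_eval x _) rmorph_bracket /=.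
rewrite rmorphM /= map_polyC map_polyX /= /horner_eval !hornerE.
by rewrite rmorphXn /= -tofracXn.
Qed.

Lemma tofrac_qpolynomial_gf b n (w : C) :
  tofrac (qpolynomial_gf w b n)
  = \prod_(i < n) bracket b (ratfun_const w ^+ i * t).
Proof.
rewrite /qpolynomial_gf rmorph_prod; apply: eq_bigr => i _.
by rewrite rmorph_bracket rmorphM /= polyC_exp rmorphXn.
Qed.

End RationalFunctions.

(** * Coefficients at quotients by d *)

Lemma polynomial_coef_div (b m d : nat) (z : int) : (0 < d)%N ->
  polynomial_coef b m%:Q (z%:Q / d%:Q)
  = if z is Posz k then (bracket b ('X^d : {poly int}) ^+ m)`_k else 0.
Proof.
move=> d_gt0; have d_pos : 0 < (d%:R : rat) by rewrite ltr0n.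
rewrite /polynomial_coef -!pmulrn natr_nat natrK.
(* A negative [z] gives a negative quotient, hence the default value 0. *)
case: z => k /=; last first.
  rewrite ifF //; apply/negbTE/negP => /natr_ge0.
  by rewrite ler_pdivlMr // mul0r ler0z.
(* Substituting ['X^d] for ['X] moves the coefficient at j to j d and puts zeros elsewhere, in
   agreement with the convention at non-integers. *)
have -> : bracket b ('X^d : {poly int}) ^+ m = (bracket b 'X ^+ m) \Po 'X^d.
  by rewrite rmorphXn /= rmorph_bracket /= comp_polyX.
rewrite coef_comp_poly_Xn // -!pmulrn.
case: ifPn => [/natrP[j Ej]|kd_nat].
  have /eqP : (k%:R : rat) = (j * d)%:R.
    by rewrite natrM -Ej divfK ?lt0r_neq0.
  by rewrite Ej natrK eqr_nat => /eqP ->; rewrite dvdn_mull // mulnK.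
by case: ifPn => // /Qnat_dvd; rewrite (negPf kd_nat).
Qed.

Lemma intr_polynomial_coef_div (R : comNzRingType) (b m d : nat) (z : int) :
  (0 < d)%N ->
  (polynomial_coef b m%:Q (z%:Q / d%:Q))%:~R
  = if z is Posz k then (bracket b ('X^d : {poly R}) ^+ m)`_k else 0.
Proof.
move=> d_gt0; rewrite polynomial_coef_div //; case: z => k //.
by rewrite -coef_map rmorphXn /= rmorph_bracket /= map_polyXn.
Qed.

Lemma coef_bracketX_mul (R : comNzRingType) b (p : {poly R}) k :
  (bracket b 'X * p)`_k = \sum_(0 <= l < b) if (k < l)%N then 0 else p`_(k - l).
Proof.
rewrite /bracket mulr_suml coef_sum big_mkord; apply: eq_bigr => l _.
by rewrite coefXnM.
Qed.

Lemma sum_intr_polynomial_coef_div (R : comNzRingType) (b m d : nat) (z : int) :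
  (0 < d)%N ->
  \sum_(0 <= l < b) (polynomial_coef b m%:Q ((z%:Q - l%:Q) / d%:Q))%:~R
  = if z is Posz k then (bracket b 'X * bracket b ('X^d : {poly R}) ^+ m)`_k
    else 0.
Proof.
move=> d_gt0.
under eq_bigr do rewrite -rmorphB /= intr_polynomial_coef_div //.
(* For negative [z] every [z - l] is negative too, so all terms vanish. *)
case: z => k; last by rewrite big1 // => l _; rewrite NegzE -opprD -PoszD addSn.
rewrite coef_bracketX_mul; apply: eq_bigr => l _.
case: ltnP => [lt_kl | le_lk]; last by rewrite subzn.
(* Here k - l is negative; it is put in the form [Negz (l - k.+1)] so that the match reduces to
   0. *)
by rewrite -opprB subzn 1?ltnW // -(subnSK lt_kl) -NegzE.
Qed.

(** * Elementary symmetric polynomials as coefficients *)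

Lemma meval_mesym_coef (R : comNzRingType) n (c : 'I_n -> R) k :
  (mesym n R k).@[c] = (\prod_(i < n) (1 + (c i)%:P * 'X))`_k.
Proof.
rewrite mesymE rmorph_sum /=.
(* With the linear term first, the expansion runs over the sets [h] of factors contributing it; only
   those of cardinality k reach t^k. *)
under [\prod_(_ < _) _]eq_bigr do rewrite addrC.
rewrite bigA_distr coef_sum /= [RHS]big_mkcond /= [LHS]big_mkcond.
apply: eq_bigr => h _.
rewrite -big_mkcond /= big_split /= prodr_const -rmorph_prod /= coefCM coefXn.
rewrite eq_sym mevalX; case: eqP => _; rewrite ?mulr0 ?mulr1 //.
rewrite [RHS]big_mkcond; apply: eq_bigr => i _.
by rewrite mnmE; case: ifP => _; rewrite ?expr1 ?expr0.
Qed.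

(** * The q-binomial theorem *)

Section QBinomial.

Local Notation q := ('X : {poly int}).

(** Gaussian binomials without division. Of the two q-Pascal rules, this is the one obtained by
    splitting off the last factor 1 + q^n t of the product. *)
Fixpoint qbinomial_pascal n k : {poly int} :=
  match n, k with
  | _, 0 => 1
  | 0, _.+1 => 0
  | n'.+1, k'.+1 =>
      qbinomial_pascal n' k'.+1 + q ^+ (n' - k') * qbinomial_pascal n' k'
  end.

Lemma qbinomial_pascal0 n : qbinomial_pascal n 0 = 1.
Proof. by case: n. Qed.

Lemma qbinomial_pascal_small n k : (n < k)%N -> qbinomial_pascal n k = 0.
Proof.
elim: n k => [|n IHn] [|k] //= lt_nk.
by rewrite !IHn ?mulr0 ?addr0 // ltnW.
Qed.

Lemma qfactorialS n : qfactorial n.+1 = qfactorial n * bracket n.+1 q.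
Proof. by rewrite /qfactorial big_nat_recr. Qed.

Lemma qfactorial0 : qfactorial 0 = 1.
Proof. by rewrite /qfactorial big_geq. Qed.

Lemma bracketD (R : pzSemiRingType) m n (x : R) :
  bracket (m + n) x = bracket m x + x ^+ m * bracket n x.
Proof.
rewrite /bracket big_split_ord /= mulr_sumr; congr (_ + _).
by apply: eq_bigr => i _; rewrite exprD.
Qed.

(** By induction the two Pascal terms contribute [n]! [n-k] and [n]! q^(n-k) [k+1], and [n-k] +
    q^(n-k) [k+1] = [n+1]. *)
Lemma qbinomial_pascal_factorial n k : (k <= n)%N ->
  qbinomial_pascal n k * (qfactorial k * qfactorial (n - k)) = qfactorial n.
Proof.
elim: n k => [|n IHn] [|k] //= le_kn.
- by rewrite qfactorial0 !mulr1.
- by rewrite qfactorial0 !mul1r subn0.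
rewrite subSS mulrDl.
have -> : q ^+ (n - k) * qbinomial_pascal n k
            * (qfactorial k.+1 * qfactorial (n - k))
  = qfactorial n * (q ^+ (n - k) * bracket k.+1 q).
  by rewrite -(IHn k le_kn) qfactorialS; ring.
have -> : qbinomial_pascal n k.+1
            * (qfactorial k.+1 * qfactorial (n - k))
  = qfactorial n * bracket (n - k) q.
  have [lt_kn|le_nk] := ltnP k n.
    rewrite -(IHn k.+1 lt_kn) -(subnSK lt_kn) (qfactorialS (n - k.+1)); ring.
  (* In the boundary case k = n the first Pascal term and [n-k] = [0] both vanish. *)
  have -> : k = n by apply/eqP; rewrite eqn_leq -ltnS le_kn.
  by rewrite qbinomial_pascal_small // subnn /bracket big_ord0 mul0r mulr0.
by rewrite -mulrDr -bracketD addnS subnK // -qfactorialS.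
Qed.

Lemma monic_bracketX n : bracket n.+1 q \is monic.
Proof.
rewrite /bracket; under eq_bigr do rewrite -[_ ^+ _]scale1r.
rewrite -(poly_def n.+1 (fun=> 1 : int)).
by rewrite monicE lead_coef_poly.
Qed.

Lemma monic_qfactorial n : qfactorial n \is monic.
Proof.
elim: n => [|n IHn]; first by rewrite qfactorial0 monic1.
by rewrite qfactorialS monicMl ?monic_bracketX.
Qed.

(** The factorial identity exhibits the divisor as a factor, and its monicity lets the quotient
    cancel it over the integers. *)
Lemma qbinomialE n k : qbinomial n k = qbinomial_pascal n k.
Proof.
rewrite /qbinomial; case: leqP => [le_kn|/qbinomial_pascal_small ->//].
rewrite -(qbinomial_pascal_factorial le_kn) Pdiv.IdomainMonic.mulpK //.
by rewrite monicMl ?monic_qfactorial.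
Qed.

Lemma q_binomial_theorem n k :
  (\prod_(i < n) bracket 2 ((q ^+ i)%:P * 'X : {poly {poly int}}))`_k
  = q ^+ 'C(k, 2) * qbinomial n k.
Proof.
rewrite qbinomialE; elim: n k => [|n IHn] k.
  by rewrite big_ord0 coef1; case: k => [|k]; rewrite ?mul1r ?mulr0.
rewrite big_ord_recr /= bracket2 mulrDr mulr1 coefD mulrCA coefCM coefMX !IHn.
case: k => [|k] /=; first by rewrite mulr0 addr0 qbinomial_pascal0.
(* The exponents agree because C(k+1,2) + (n-k) = C(k,2) + n when k <= n; for k > n the subtraction
   truncates, but the polynomial is 0. *)
rewrite mulrDr; congr (_ + _); rewrite binS bin1 !mulrA -!exprD.
have [lt_nk|le_kn] := ltnP n k.
  by rewrite qbinomial_pascal_small // !mulr0.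
by rewrite -addnA subnKC // addnC.
Qed.

End QBinomial.

(** * The special case b = 2 *)

Lemma eval_at_qbinomial (R : comNzRingType) (w : R) (n k : nat) :
  w ^+ k * eval_at w (qpolynomial_coef 2 n%:Q k%:Q)
  = w ^+ (k * (k + 1) %/ 2) * eval_at w (qbinomial n k).
Proof.
rewrite /qpolynomial_coef -!pmulrn !natr_nat /= !natrK q_binomial_theorem.
rewrite /eval_at rmorphM /= map_polyXn hornerM hornerXn mulrA -exprD.
(* The exponents match by k + C(k,2) = C(k+1,2) = k(k+1)/2. *)
by rewrite addn1 divn2 mulnC -[_./2](bin2 k.+1) binS bin1 addnC.
Qed.

Lemma meval_mesym_powers (R : comNzRingType) (w : R) (n k : nat) :
  (mesym n R k).@[fun i : 'I_n => w ^+ i.+1]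
  = w ^+ k * eval_at w (qpolynomial_coef 2 n%:Q k%:Q).
Proof.
rewrite meval_mesym_coef eval_at_qpolynomial -coef_qpolynomial_gf_scale.
by under [in RHS]eq_bigr do rewrite bracket2.
Qed.

(** For odd [m] the gcd is 1 and the quotient is 1 + x^m; for even [m] the gcd is 2 and it is 1 -
    x^m. The power of [- x] unites both parities. *)
Lemma divr_cyclotomic2 (F : fieldType) (m : nat) (x : F) :
  x ^+ m != 1 ->
  (1 - x ^+ (2 * m %/ gcdn 2 m)) ^+ gcdn 2 m / (1 - x ^+ m) = 1 - (- x) ^+ m.
Proof.
move=> xm_neq1; have xm_unit : 1 - x ^+ m != 0 by rewrite subr_eq0 eq_sym.
have [m_odd|m_even] := boolP (odd m).
  have /eqP -> : coprime 2 m by rewrite coprime2n.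
  rewrite divn1 expr1 mulnC exprM exprNn -signr_odd m_odd.
  by apply: (mulIf xm_unit); rewrite divfK //; ring.
have /gcdn_idPl -> : (2 %| m)%N by rewrite dvdn2.
rewrite mulKn // expr2 mulfK // exprNn -signr_odd (negPf m_even) expr0.
by rewrite mul1r.
Qed.

(** The numerator 1 - (-x)^(n+1) is a geometric sum in -x times 1 + x, and 1 + x is [2]_x. *)
Lemma alternating_sum_quotient (F : fieldType) (n : nat) (x : F) :
  1 + x != 0 -> x ^+ (n + 1) != 1 ->
  (bracket 2 x)^-1
  * ((1 - x ^+ (2 * (n + 1) %/ gcdn 2 (n + 1))) ^+ gcdn 2 (n + 1)
     / (1 - x ^+ (n + 1)))
  = \sum_(0 <= k < n.+1) (-1) ^+ k * x ^+ k.
Proof.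
move=> x_neqN1 xn_neq1; rewrite divr_cyclotomic2 // -bracket_geometric bracket2.
rewrite opprK mulrC mulfK // addn1 /bracket big_mkord.
by apply: eq_bigr => k _; rewrite -exprNn.
Qed.

(** * The three product formulas at a primitive root *)

Section Coefficients.

Variables (C : fieldType) (d : nat) (w : C).
Hypothesis w_prim : d.-primitive_root w.
Let K := {fraction {poly C}}.
Let t : K := ratfun_t C.
Let W : K := ratfun_const w.

Let d_gt0 : (0 < d)%N := prim_order_gt0 w_prim.

Lemma ratfun_const_primitive_root : d.-primitive_root W.
Proof.
pose f : {rmorphism C -> K} := @tofrac {poly C} \o polyC.
by rewrite -[W]/(f w) fmorph_primitive_root.
Qed.

Lemma prod_bracket_ratfun b n : (d %| n)%N ->
  \prod_(i < n) bracket b (W ^+ i * t)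
  = ((1 - t ^+ (b * d %/ gcdn b d)) ^+ gcdn b d / (1 - t ^+ d)) ^+ (n %/ d).
Proof.
apply: (prod_bracket ratfun_const_primitive_root).
exact: ratfun_t_expr_neq1.
Qed.

Lemma quotient_bracket_ratfun b :
  (1 - (t ^+ d) ^+ b) / (1 - t ^+ d) = bracket b (t ^+ d).
Proof.
rewrite -bracket_geometric mulfK // subr_eq0 eq_sym.
exact: ratfun_t_expr_neq1.
Qed.

Lemma coprime_quotient_bracket_ratfun b : gcdn b d = 1%N ->
  (1 - t ^+ (b * d %/ gcdn b d)) ^+ gcdn b d / (1 - t ^+ d)
  = bracket b (t ^+ d).
Proof.
by move=> ->; rewrite divn1 expr1 mulnC exprM; exact: quotient_bracket_ratfun.
Qed.

Lemma bracket_ratfunXn b e : bracket b (t ^+ e) = tofrac (bracket b 'X^e).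
Proof. by rewrite rmorph_bracket rmorphXn. Qed.

Lemma prod_bracket_ratfun_rem1 b n : (1 <= n)%N -> (d %| n - 1)%N ->
  \prod_(i < n) bracket b (W ^+ i * t)
  = bracket b t
    * ((1 - t ^+ (b * d %/ gcdn b d)) ^+ gcdn b d / (1 - t ^+ d))
      ^+ ((n - 1) %/ d).
Proof.
case: n => // n _; rewrite subn1 /= => d_dvd.
rewrite big_ord_recr /= prod_bracket_ratfun // mulrC.
have /eqP -> : W ^+ n == 1.
  by rewrite -(prim_order_dvd ratfun_const_primitive_root).
by rewrite mul1r.
Qed.

Lemma prod_bracket_ratfun_shift b n : (0 < b)%N -> (d %| n + 1)%N ->
  \prod_(i < n) bracket b (W ^+ i.+1 * t)
  = (bracket b t)^-1
    * ((1 - t ^+ (b * d %/ gcdn b d)) ^+ gcdn b d / (1 - t ^+ d))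
      ^+ ((n + 1) %/ d).
Proof.
move=> b_gt0; rewrite addn1 => d_dvd; rewrite -prod_bracket_ratfun //.
by rewrite big_ord_recl expr0 mul1r mulKf // bracket_ratfun_t_neq0.
Qed.

Lemma sum_qpolynomial_scale b (n : nat) : (0 < b)%N ->
  \sum_(0 <= k < ((b - 1) * n).+1)
     ratfun_const (w ^+ k * eval_at w (qpolynomial_coef b n%:Q k%:Q)) * t ^+ k
  = \prod_(i < n) bracket b (W ^+ i.+1 * t).
Proof.
(* Regrouping the argument as [W ^+ i * (W * t)] allows [sum_qpolynomial] at the point [W * t]. *)
move=> b_gt0; under [RHS]eq_bigr do rewrite exprSr -mulrA.
rewrite -sum_qpolynomial //; apply: eq_bigr => k _.
rewrite exprMn mulrA; congr (_ * _).
by rewrite mulrC /ratfun_const polyCM tofracM polyC_exp tofracXn.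
Qed.

Lemma qpolynomial_gf_coprime b n : gcdn b d = 1%N -> (d %| n)%N ->
  qpolynomial_gf w b n = bracket b 'X^d ^+ (n %/ d).
Proof.
move=> bd_coprime d_dvd; apply/eqP; rewrite -tofrac_eq; apply/eqP.
rewrite tofrac_qpolynomial_gf prod_bracket_ratfun //.
by rewrite coprime_quotient_bracket_ratfun // tofracXn -bracket_ratfunXn.
Qed.

Lemma qpolynomial_gf_coprime_rem1 b n :
  gcdn b d = 1%N -> (1 <= n)%N -> (d %| n - 1)%N ->
  qpolynomial_gf w b n = bracket b 'X * bracket b 'X^d ^+ ((n - 1) %/ d).
Proof.
move=> bd_coprime n_gt0 d_dvd; apply/eqP; rewrite -tofrac_eq; apply/eqP.
rewrite tofrac_qpolynomial_gf prod_bracket_ratfun_rem1 //.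
rewrite coprime_quotient_bracket_ratfun // tofracM tofracXn -bracket_ratfunXn.
by rewrite rmorph_bracket.
Qed.

End Coefficients.

(** Both sides are kth coefficients of polynomials, which are compared in C(t) through the
    alternating sum. *)
Lemma scaled_qpolynomial_sign (C : fieldType) (w : C) (n k : nat) :
  (n + 1).-primitive_root w ->
  w ^+ k * eval_at w (qpolynomial_coef 2 n%:Q k%:Q)
  = if (k < n + 1)%N then (-1) ^+ k else 0.
Proof.
move=> w_prim; rewrite eval_at_qpolynomial -coef_qpolynomial_gf_scale addn1.
rewrite -(coef_poly n.+1 (fun k => (-1) ^+ k)); congr (nth _ (polyseq _) _).
apply/eqP; rewrite -tofrac_eq; apply/eqP.
rewrite poly_def !rmorph_prod rmorph_sum /=.
transitivity (\sum_(0 <= k < n.+1) (-1) ^+ k * ratfun_t C ^+ k); last first.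
  rewrite big_mkord; apply: eq_bigr => i _.
  by rewrite -mul_polyC rmorphM !rmorph_sign rmorphXn.
rewrite -alternating_sum_quotient; last 2 first.
- by rewrite -bracket2 bracket_ratfun_t_neq0.
- by rewrite ratfun_t_expr_neq1 ?addn1.
have := prod_bracket_ratfun_shift w_prim (isT : (0 < 2)%N) (dvdnn _).
(* The order of [w] is n + 1 itself, so the outer exponent is 1. *)
rewrite divnn addn1 /= expr1 => <-; apply: eq_bigr => i _.
by rewrite rmorph_bracket rmorphM /= polyC_exp rmorphXn.
Qed.

(** * Assembly of the three cases *)

Theorem theorem3p3 (C : numClosedFieldType) (b n d : nat) (w : C)
    (hb : (2 <= b)%N) (hn : (1 <= n)%N) (hd : (1 <= d)%N)
    (hw : d.-primitive_root w) :
  let g := gcdn b d in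
  let t := ratfun_t C in
  [/\          
      (d %| n)%N ->
        \sum_(0 <= k < ((b - 1) * n).+1)
            ratfun_const (eval_at w (qpolynomial_coef b n%:Q k%:Q)) * t ^+ k
          = ((1 - t ^+ (b * d %/ g)) ^+ g / (1 - t ^+ d)) ^+ (n %/ d)
        /\
        (g = 1%N ->
          [/\ \sum_(0 <= k < ((b - 1) * n).+1)
                  ratfun_const (eval_at w (qpolynomial_coef b n%:Q k%:Q)) * t ^+ k
                = ((1 - (t ^+ d) ^+ b) / (1 - t ^+ d)) ^+ (n %/ d),
              ((1 - (t ^+ d) ^+ b) / (1 - t ^+ d)) ^+ (n %/ d)
                = bracket b (t ^+ d) ^+ (n %/ d)
            & forall k : int,
                eval_at w (qpolynomial_coef b n%:Q k%:Q)
                = (polynomial_coef b (n%:Q / d%:Q) (k%:Q / d%:Q))%:~R]),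
               
      (d %| n - 1)%N ->
        \sum_(0 <= k < ((b - 1) * n).+1)
            ratfun_const (eval_at w (qpolynomial_coef b n%:Q k%:Q)) * t ^+ k
          = bracket b t
            * ((1 - t ^+ (b * d %/ g)) ^+ g / (1 - t ^+ d)) ^+ ((n - 1) %/ d)
        /\
        (g = 1%N ->
          \sum_(0 <= k < ((b - 1) * n).+1)
              ratfun_const (eval_at w (qpolynomial_coef b n%:Q k%:Q)) * t ^+ k
            = bracket b t * bracket b (t ^+ d) ^+ ((n - 1) %/ d)
          /\
          forall k : int,
            eval_at w (qpolynomial_coef b n%:Q k%:Q)
            = \sum_(0 <= l < b)
                (polynomial_coef b ((n%:Q - 1) / d%:Q)
                                   ((k%:Q - l%:Q) / d%:Q))%:~R)
    &          
      (d %| n + 1)%N ->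
        [/\ \sum_(0 <= k < ((b - 1) * n).+1)
                ratfun_const
                  (w ^+ k * eval_at w (qpolynomial_coef b n%:Q k%:Q)) * t ^+ k
              = (bracket b t)^-1
                * ((1 - t ^+ (b * d %/ g)) ^+ g / (1 - t ^+ d)) ^+ ((n + 1) %/ d),
            g = 1%N ->
              \sum_(0 <= k < ((b - 1) * n).+1)
                  ratfun_const
                    (w ^+ k * eval_at w (qpolynomial_coef b n%:Q k%:Q)) * t ^+ k
                = (bracket b t)^-1 * bracket b (t ^+ d) ^+ ((n + 1) %/ d)
          & b = 2%N -> d = (n + 1)%N ->
              (bracket 2 t)^-1
                * ((1 - t ^+ (2 * (n + 1) %/ g)) ^+ g / (1 - t ^+ (n + 1)))
              = \sum_(0 <= k < n.+1) (-1) ^+ k * t ^+ k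
              /\
              forall k : nat,
                [/\ (mesym n C k).@[fun i : 'I_n => w ^+ i.+1]
                      = w ^+ k * eval_at w (qpolynomial_coef 2 n%:Q k%:Q),
                    w ^+ k * eval_at w (qpolynomial_coef 2 n%:Q k%:Q)
                      = w ^+ (k * (k + 1) %/ 2) * eval_at w (qbinomial n k)
                  & w ^+ (k * (k + 1) %/ 2) * eval_at w (qbinomial n k)
                      = if (k < n + 1)%N then (-1) ^+ k else 0]]].
Proof.
have b_gt0 : (0 < b)%N := ltnW hb.
have d_neq0 : (d%:R : rat) != 0 by rewrite pnatr_eq0 -lt0n.
move=> g t; split=> d_dvd.
- rewrite sum_qpolynomial // (prod_bracket_ratfun hw) //.
  split=> // bd_coprime; rewrite (quotient_bracket_ratfun hw).
  rewrite (coprime_quotient_bracket_ratfun hw) //; split=> // k.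
  (* Divisibility turns the rational upper index into a natural number; only the lower index may
     remain fractional. *)
  have -> : n%:Q / d%:Q = (n %/ d)%N%:Q.
    by rewrite -{1}(divnK d_dvd) PoszM rmorphM /= mulfK.
  rewrite intr_polynomial_coef_div //; case: k => k.
    by rewrite eval_at_qpolynomial (qpolynomial_gf_coprime hw).
  exact: eval_at_qpolynomial_neg.
- rewrite sum_qpolynomial // (prod_bracket_ratfun_rem1 hw) //.
  split=> // bd_coprime; rewrite (coprime_quotient_bracket_ratfun hw) //.
  split=> // k.
  have -> : (n%:Q - 1) / d%:Q = ((n - 1) %/ d)%N%:Q.
    (* Since n >= 1, the natural subtraction n - 1 is not truncated and agrees with the rational
       one. *)
    rewrite -(rmorphB _ (n : int) 1) /= subzn // -{1}(divnK d_dvd).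
    by rewrite PoszM rmorphM /= mulfK.
  rewrite sum_intr_polynomial_coef_div //; case: k => k.
    by rewrite eval_at_qpolynomial (qpolynomial_gf_coprime_rem1 hw).
  exact: eval_at_qpolynomial_neg.
rewrite sum_qpolynomial_scale // (prod_bracket_ratfun_shift hw) //.
split=> // [bd_coprime|b2 dE].
  by rewrite (coprime_quotient_bracket_ratfun hw).
split=> [|k].
  rewrite /g b2 dE alternating_sum_quotient //.
    by rewrite -bracket2 bracket_ratfun_t_neq0.
  by rewrite ratfun_t_expr_neq1 ?addn1.
rewrite dE in hw.
by rewrite meval_mesym_powers -eval_at_qbinomial (scaled_qpolynomial_sign _ hw).
Qed.
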